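(* Let $n\geq 2$, let $G\cong Q_{4n}$ be the generalized quaternion group of order $4n$, and let $H=\mathcal{D}(G)$. Suppose $V$ is a finite-dimensional complex $G$-module and $W$ is a finite-dimensional $H$-module. Then for every $m\in\mathbb{N}$ we have $\nu_m(V)\in\mathbb{Z}$ and $\nu_m(W)\in\mathbb{Z}$.
   Context: $\mathbb{N}=\{1,2,3,\dots\}$. For $2\leq n\in\mathbb{N}$, $Q_{4n}=\langle a,b\mid a^{2n}=1,\ b^2=a^n,\ bab^{-1}=a^{-1}\rangle$. For a $G$-module $V$ with character $\chi$, $\nu_m(V)=\frac{1}{|G|}\sum_{g\in G}\chi(g^m)$. For a finite group $G$, the Drinfel'd double $\mathcal{D}(G)$ is the complex Hopf algebra with basis $\{p_g\bowtie x : g,x\in G\}$, multiplication $(p_g\bowtie x)(p_h\bowtie y)=\delta_{g,xhx^{-1}}\,p_g\bowtie xy$, unit $\sum_g p_g\bowtie 1$, comultiplication $\Delta(p_g\bowtie x)=\sum_{uv=g}(p_u\bowtie x)\otimes(p_v\bowtie x)$ and counit $\epsilon(p_g\bowtie x)=\delta_{g,1}$. Its integral with counit value 1 is $\Lambda=\frac{1}{|G|}\sum_{x\in G}p_1\bowtie x$. Put $\Lambda^{[m]}=\sum\Lambda_1\Lambda_2\cdots\Lambda_m$ (the product of the $m$ tensor factors of the iterated comultiplication of $\Lambda$). For a finite-dimensional $\mathcal{D}(G)$-module $W$ with character $\chi$, the $m$-th indicator is $\nu_m(W)=\chi(\Lambda^{[m]})$. *)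

(* Defs.v *)
From HB Require Import structures.
From mathcomp Require Import all_boot all_order all_algebra.
From mathcomp Require Import all_fingroup all_solvable all_character.
From mathcomp Require Import complex reals.

Set Implicit Arguments.
Unset Strict Implicit.
Unset Printing Implicit Defensive.

Import GRing.Theory.
Local Open Scope ring_scope.

(* The presentation characterises a finite group up to isomorphism by its     *)
(* finite quotients, which is enough here because the abstract group          *)
(* < a, b | a^{2n} = 1, b^2 = a^n, b a b^{-1} = a^{-1} > is finite.           *)
Definition gen_quaternion (gT : finGroupType) (G : {set gT}) (n : nat) : Prop :=
  (G \isog Grp (a : b : a ^+ (2 * n), b ^+ 2 = a ^+ n, b * a * b^-1 = a^-1))%g.

Definition group_indicator (K : fieldType) (gT : finGroupType)
    (G : {group gT}) (d : nat) (rG : mx_representation K G d) (m : nat) : K :=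
  #|G|%:R^-1 * \sum_(g in G) \tr (rG (g ^+ m)%g).

(* A vector of the double is its coordinate function; the coordinate at       *)
(* (g, x) is the coefficient of p_g \bowtie x.                                *)
Definition drinfeld_double (K : fieldType) (gT : finGroupType) : Type :=
  {ffun gT * gT -> K}.

Section Double.

Variables (K : fieldType) (gT : finGroupType).

Local Notation D := (drinfeld_double K gT).

HB.instance Definition _ := GRing.Lmodule.copy D {ffun gT * gT -> K^o}.

Definition dbasis (g x : gT) : D := [ffun b => (b == (g, x))%:R].

Definition dmul_basis (b c : gT * gT) : D :=
  (b.1 == (b.2 * c.1 * b.2^-1)%g)%:R *: dbasis b.1 (b.2 * c.2)%g.

Definition dmul (f h : D) : D := \sum_b \sum_c (f b * h c) *: dmul_basis b c.

Definition done1 : D := \sum_g dbasis g 1%g.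

Lemma dbasisE (g x : gT) b : dbasis g x b = (b == (g, x))%:R.
Proof. by rewrite ffunE. Qed.

Lemma double_sumE (I : finType) (P : pred I) (F : I -> D) b :
  (\sum_(i | P i) F i) b = \sum_(i | P i) F i b.
Proof. exact: sum_ffunE. Qed.

Lemma double_scaleE a (f : D) b : (a *: f) b = a * f b.
Proof. by rewrite ffunE. Qed.

Lemma double_decomp (f : D) : f = \sum_b f b *: dbasis b.1 b.2.
Proof.
apply/ffunP => c; rewrite double_sumE (bigD1 c) //= double_scaleE dbasisE.
rewrite -surjective_pairing eqxx mulr1 big1 ?addr0 // => b nbc.
by rewrite double_scaleE dbasisE -surjective_pairing eq_sym (negPf nbc) mulr0.
Qed.

Lemma dmulDl : left_distributive dmul +%R.
Proof.
move=> f g h; rewrite /dmul -big_split; apply: eq_bigr => b _ /=.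
rewrite -big_split; apply: eq_bigr => c _ /=.
by rewrite ffunE mulrDl scalerDl.
Qed.

Lemma dmulDr : right_distributive dmul +%R.
Proof.
move=> f g h; rewrite /dmul -big_split; apply: eq_bigr => b _ /=.
rewrite -big_split; apply: eq_bigr => c _ /=.
by rewrite ffunE mulrDr scalerDl.
Qed.

Lemma dmulZl a f h : a *: dmul f h = dmul (a *: f) h.
Proof.
rewrite /dmul scaler_sumr; apply: eq_bigr => b _.
rewrite scaler_sumr; apply: eq_bigr => c _.
by rewrite double_scaleE scalerA mulrA.
Qed.

Lemma dmulZr a f h : a *: dmul f h = dmul f (a *: h).
Proof.
rewrite /dmul scaler_sumr; apply: eq_bigr => b _.
rewrite scaler_sumr; apply: eq_bigr => c _.
by rewrite double_scaleE scalerA mulrCA.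
Qed.

Lemma dmul_suml (I : finType) (F : I -> D) h :
  dmul (\sum_i F i) h = \sum_i dmul (F i) h.
Proof.
apply: (big_morph (dmul^~ h)) => [f g|]; first exact: dmulDl.
by have := dmulZl 0 0 h; rewrite !scale0r => <-.
Qed.

Lemma dmul_sumr (I : finType) (F : I -> D) f :
  dmul f (\sum_i F i) = \sum_i dmul f (F i).
Proof.
apply: (big_morph (dmul f)) => [g h|]; first exact: dmulDr.
by have := dmulZr 0 f 0; rewrite !scale0r => <-.
Qed.

Lemma dmul_basisE g x h y :
  dmul (dbasis g x) (dbasis h y) =
  (g == (x * h * x^-1)%g)%:R *: dbasis g (x * y)%g.
Proof.
rewrite /dmul (bigD1 (g, x)) //= [X in _ + X]big1 ?addr0 => [|b nb].
  rewrite (bigD1 (h, y)) //= [X in _ + X]big1 ?addr0 => [|c nc].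
    by rewrite !dbasisE !eqxx mulr1 scale1r.
  by rewrite [dbasis h y _]dbasisE (negPf nc) mulr0 scale0r.
by rewrite big1 // => c _; rewrite dbasisE (negPf nb) mul0r scale0r.
Qed.

Lemma dmul_basisA g1 x1 g2 x2 g3 x3 :
  dmul (dbasis g1 x1) (dmul (dbasis g2 x2) (dbasis g3 x3)) =
  dmul (dmul (dbasis g1 x1) (dbasis g2 x2)) (dbasis g3 x3).
Proof.
rewrite !dmul_basisE -dmulZr -dmulZl !dmul_basisE !scalerA mulgA.
congr (_ *: _); rewrite -!natrM !mulnb; congr (nat_of_bool _)%:R.
rewrite andbC; apply: andb_id2l => /eqP ->.
by rewrite invMg !mulgA (inj_eq (mulIg _)) -!mulgA (inj_eq (mulgI _)).
Qed.

Lemma dmulA : associative dmul.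
Proof.
move=> f g h; rewrite [f]double_decomp dmul_suml [dmul _ g]dmul_suml.
rewrite dmul_suml; apply: eq_bigr => -[g1 x1] _ /=.
rewrite [g]double_decomp [dmul _ h]dmul_suml !dmul_sumr dmul_suml.
apply: eq_bigr => -[g2 x2] _ /=.
pose H b := h b *: dbasis b.1 b.2; have ->: h = \sum_b H b := double_decomp h.
rewrite !(dmul_sumr H) (dmul_sumr (fun b => dmul _ (H b))).
apply: eq_bigr => -[g3 x3] _; rewrite /H /=.
rewrite -[in LHS]dmulZl -[X in dmul _ X]dmulZl -![in RHS]dmulZl.
by rewrite -!dmulZr -[in RHS]dmulZl dmul_basisA !scalerA mulrAC.
Qed.

Lemma dmul1r : left_id done1 dmul.
Proof.
move=> f; rewrite [f in LHS]double_decomp [RHS]double_decomp dmul_sumr.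
apply: eq_bigr => -[g x] _ /=; rewrite -dmulZr dmul_suml; congr (_ *: _).
rewrite (bigD1 g) //= big1 ?addr0 => [|h nhg].
  by rewrite dmul_basisE !mul1g invg1 mulg1 eqxx scale1r.
by rewrite dmul_basisE mul1g invg1 mulg1 (negPf nhg) scale0r.
Qed.

Lemma dmulr1 : right_id done1 dmul.
Proof.
move=> f; rewrite [f in LHS]double_decomp [RHS]double_decomp dmul_suml.
apply: eq_bigr => -[g x] _ /=; rewrite -dmulZl dmul_sumr; congr (_ *: _).
rewrite (bigD1 (g ^ x)%g) //= big1 ?addr0 => [|h nhg].
  by rewrite dmul_basisE conjgE !mulgA mulgV mul1g mulgK eqxx mulg1 scale1r.
rewrite dmul_basisE; case: eqP => [def_g|_]; last by rewrite scale0r.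
by case/eqP: nhg; rewrite def_g conjgE !mulgA mulVg mul1g mulgKV.
Qed.

Lemma done1_neq0 : done1 != 0.
Proof.
apply/eqP => /ffunP/(_ (1%g, 1%g)); rewrite double_sumE !ffunE.
rewrite (bigD1 1%g) //= dbasisE eqxx big1 ?addr0 => [/eqP|g ng1].
  by rewrite oner_eq0.
by rewrite dbasisE xpair_eqE eq_sym (negPf ng1).
Qed.

HB.instance Definition _ := GRing.Zmodule_isNzRing.Build D
  dmulA dmul1r dmulr1 dmulDl dmulDr done1_neq0.
HB.instance Definition _ := GRing.Lmodule_isLalgebra.Build K D dmulZl.
HB.instance Definition _ := GRing.Lalgebra_isAlgebra.Build K D dmulZr.

Lemma double_mulE g x h y :
  dbasis g x * dbasis h y =
  (g == (x * h * x^-1)%g)%:R *: dbasis g (x * y)%g.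
Proof. exact: dmul_basisE. Qed.

(* The m-th tensor power of the double is represented by its coordinates on   *)
(* the basis of pure tensors of basis vectors, indexed by m-tuples of pairs.  *)
Definition dcomul (f : D) : {ffun (gT * gT) * (gT * gT) -> K} :=
  [ffun c => \sum_(b : gT * gT) \sum_(u : gT) \sum_(v : gT | (u * v)%g == b.1)
    f b * (c == ((u, b.2), (v, b.2)))%:R].

Definition dcounit (f : D) : K := \sum_(b : gT * gT) f b * (b.1 == 1%g)%:R.

(* Delta^(0) = epsilon, Delta^(m+1) = (id (x) Delta^(m)) o Delta; the counit  *)
(* axiom makes Delta^(1) the identity, see dcomul_iter1 and dcomul_iter2.     *)
Fixpoint dcomul_iter (m : nat) : D -> {ffun m.-tuple (gT * gT) -> K} :=
  match m with
  | 0 => fun f => [ffun=> dcounit f]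
  | k.+1 => fun f => [ffun t : k.+1.-tuple (gT * gT) =>
      \sum_(c : gT * gT)
        dcomul f (thead t, c) * dcomul_iter k (dbasis c.1 c.2) (behead_tuple t)]
  end.

Definition dmul_tensor (m : nat) (F : {ffun m.-tuple (gT * gT) -> K}) : D :=
  \sum_(t : m.-tuple (gT * gT)) F t *: \prod_(b <- t) dbasis b.1 b.2.

Definition dsweedler_pow (m : nat) (f : D) : D :=
  dmul_tensor (dcomul_iter m f).

Definition dintegral : D := #|gT|%:R^-1 *: \sum_(x : gT) dbasis 1%g x.

Definition double_indicator (d : nat) (rho : {lrmorphism D -> 'M[K]_d})
    (m : nat) : K :=
  \tr (rho (dsweedler_pow m dintegral)).

Lemma dcomulE (f : D) g x h y :
  dcomul f ((g, x), (h, y)) = (x == y)%:R * f ((g * h)%g, x).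
Proof.
rewrite ffunE (bigD1 ((g * h)%g, x)) //= [X in _ + X]big1 ?addr0.
  rewrite (bigD1 g) //= (bigD1 h) //= big1 ?addr0 => [|v /andP[_ nvh]].
    rewrite big1 ?addr0 => [|u nug]; last first.
      by apply: big1 => v _; rewrite !xpair_eqE eq_sym (negPf nug) mulr0.
    by rewrite mulrC !xpair_eqE !eqxx /= [y == x]eq_sym.
  by rewrite !xpair_eqE [h == v]eq_sym (negPf nvh) andbF mulr0.
move=> [k z]; rewrite xpair_eqE negb_and /= => nkz.
apply: big1 => u _; apply: big1 => v /eqP def_k.
rewrite !xpair_eqE; case: eqP => [gu|_]; last by rewrite mulr0.
case: eqP => [xz|_]; last by rewrite mulr0.
case: eqP => [hv|_]; last by rewrite mulr0.
by rewrite -def_k gu xz hv !eqxx in nkz.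
Qed.

Lemma dcounit_basis g x : dcounit (dbasis g x) = (g == 1%g)%:R.
Proof.
rewrite /dcounit (bigD1 (g, x)) //= dbasisE eqxx mul1r big1 ?addr0 // => b nb.
by rewrite dbasisE (negPf nb) mul0r.
Qed.

Lemma dcomul_iter1 (f : D) t : dcomul_iter 1 f t = f (thead t).
Proof.
rewrite ffunE; case: (thead t) => g x; rewrite (bigD1 (1%g, x)) //= big1.
  by rewrite dcomulE ffunE dcounit_basis !eqxx mul1r mulg1 mulr1 addr0.
case=> h y nhy; rewrite dcomulE ffunE dcounit_basis /=; case: eqP => [xy|_].
  by rewrite xy xpair_eqE eqxx andbT in nhy; rewrite (negPf nhy) mulr0.
by rewrite !mul0r.
Qed.

Lemma dcomul_iter2 (f : D) b c : dcomul_iter 2 f [tuple b; c] = dcomul f (b, c).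
Proof.
rewrite [LHS]ffunE.
rewrite (eq_bigr (fun e => dcomul f (b, e) * (c == e)%:R)) => [|e _].
  rewrite (bigD1 c) //= eqxx mulr1 big1 ?addr0 // => e nec.
  by rewrite eq_sym (negPf nec) mulr0.
by rewrite dcomul_iter1 dbasisE -surjective_pairing.
Qed.

Lemma dcounit_integral : #|gT|%:R != 0 :> K -> dcounit dintegral = 1.
Proof.
move=> nz; rewrite /dcounit.
under eq_bigr => b _ do rewrite double_scaleE double_sumE -mulrA mulr_suml.
rewrite -mulr_sumr exchange_big /=.
rewrite (eq_bigr (fun=> 1)) => [|x _]; first by rewrite sumr_const mulVf.
by rewrite [LHS]dcounit_basis eqxx.
Qed.

Lemma dintegralP f : f * dintegral = dcounit f *: dintegral.
Proof.
rewrite /dcounit [f in LHS]double_decomp mulr_suml scaler_suml.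
apply: eq_bigr => -[g x] _ /=; rewrite -scalerA -scalerAl; congr (_ *: _).
rewrite -scalerAr scalerA mulrC -scalerA; congr (_ *: _); rewrite mulr_sumr.
under eq_bigr => y _ do rewrite double_mulE mulg1 mulgV.
rewrite -scaler_sumr; case: eqP => [->|_]; last by rewrite !scale0r.
by rewrite !scale1r [RHS](reindex_inj (mulgI x)).
Qed.

End Double.

(* Main.v *)
Require Import Defs.
From mathcomp Require Import all_boot all_order all_algebra.
From mathcomp Require Import all_fingroup all_solvable all_character.
From mathcomp Require Import complex reals ring.

Set Implicit Arguments.
Unset Strict Implicit.
Unset Printing Implicit Defensive.

Import Order.TTheory GRing.Theory Num.Theory.
Local Open Scope ring_scope.

(* Computing the Sweedler power of the integral gives                         *)
(*   nu_m(W) = 1/|G| sum_u S_u,                                               *)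
(*   S_u = sum_{x : (u x^-1)^m x^m = 1} tr_W (p_u x^m).                       *)
(* As S_u only depends on the class of u, it suffices that |C_G(u)| divides   *)
(* S_u.  Put A = <a> and z = a^n.  Elements outside A have square z, so S_u   *)
(* is explicit: for u outside A it is 2 #{x in A : x^m = c} tr (p_u c) with   *)
(* c in {1, z} (or 0), and the count is even since z acts on it freely; for u *)
(* in A it reduces to sums over A, which are 2n times the trace of an         *)
(* idempotent, plus (m even) 2n tr (p_u c).  When u is central one gains a    *)
(* further factor 2: on the complement of the fixed space of a^m (m even), or *)
(* on the complement of the fixed space of a inside it (m odd), a - a^-1 is   *)
(* invertible and anticommutes with b, so that this space has even dimension. *)

(** A module over the double is a G-graded space with a compatible action of G:
    [double_idempotent u] projects onto degree u, and the centralizer C(u) acts on that component.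
    Multiplying out the Sweedler power ([dsweedler_powE], [double_indicatorE]) gives |G| nu_m(W) as
    a sum over u of a class function S_u. The class of u contributes [G : C(u)] S_u, so integrality
    reduces to |C(u)| dividing S_u, which is [root_sum_divisible].

    For non-central u the centralizer is small and the factor is visible in the root sums. For
    central u, S_u is 0 or the sum over all x of tr (e rho(x^m)), and [power_sum_divisible] extracts
    4n from it; with e = 1 the same lemma settles nu_m(V). In that sum A and its complement each
    give 2n times an integer, and the two integers have the same parity. Two facts control the
    parity: an involution has trace congruent to the dimension modulo 2 ([involution_trace]), and a
    space on which an invertible matrix is conjugate to its opposite has even dimension
    ([anticommuting_rank_even]). *)

Section QuaternionModel.

Variable n : nat.
Hypothesis n_gt1 : (1 < n)%N.

Local Notation point := ('Z_(2 * n) * bool)%type.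

(* Left multiplication by a and by b on a^i b^s, encoded as (i, s). *)
Definition left_a (p : point) : point := (p.1 + 1, p.2).

Definition left_b (p : point) : point :=
  (if p.2 then n%:R - p.1 else - p.1, ~~ p.2).

Lemma left_a_inj : injective left_a.
Proof.
by apply: (can_inj (g := fun p => (p.1 - 1, p.2))) => -[i s]; rewrite addrK.
Qed.

Lemma left_b_inj : injective left_b.
Proof.
pose left_b' (p : point) := (if p.2 then - p.1 else n%:R - p.1, ~~ p.2).
by apply: (can_inj (g := left_b')) => -[i []]; rewrite /left_b' /= ?subKr ?opprK.
Qed.

Definition perm_a := perm left_a_inj.
Definition perm_b := perm left_b_inj.

Lemma perm_aX k p : (perm_a ^+ k)%g p = (p.1 + k%:R, p.2).
Proof.
elim: k => [|k IHk]; first by rewrite expg0 perm1 addr0 -surjective_pairing.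
by rewrite expgSr permM IHk permE /left_a /= -addrA -[k.+1]addn1 natrD.
Qed.

Lemma order_Zmodel : (2 * n)%:R = 0 :> 'Z_(2 * n).
Proof. by rewrite pchar_Zp // mul2n -addnn ltn_addl // ltnW. Qed.

(** Permutations compose from left to right, so products of left multiplications are reversed; each
    relation is equivalent to its reversal. *)
Lemma perm_relations :
  [/\ perm_a ^+ (2 * n) = 1, perm_b ^+ 2 = perm_a ^+ n
    & perm_b * perm_a * perm_b^-1 = perm_a^-1]%g.
Proof.
split.
- apply/permP => -[i s]; rewrite perm_aX perm1 /=.
  by rewrite order_Zmodel addr0.
- apply/permP => -[i s]; rewrite perm_aX expgS expg1 permM !permE /left_b /=.
  case: s => /=; last by rewrite opprK addrC.
  congr (_, _); apply/eqP; rewrite opprB (inj_eq (addrI i)) eq_sym -addr_eq0.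
  by rewrite -natrD addnn -mul2n order_Zmodel.
- apply: (mulIg perm_b); rewrite mulgKV; apply: (mulgI perm_a).
  rewrite mulKVg; apply/permP => -[i s]; rewrite !permM !permE /left_b /left_a.
  by case: s => /=; congr (_, _); rewrite opprD ?addrA addrNK.
Qed.

(** The products b^s a^i are distinct because they send the base point (0, false) to distinct points
    (i, s). *)
Lemma card_perm_group : (4 * n <= #|(<[perm_a]> <*> <[perm_b]>)%g|)%N.
Proof.
pose f (p : point) := (perm_b ^+ p.2 * perm_a ^+ (p.1 : nat))%g.
have f_inj : injective f.
  apply: (can_inj (g := fun s : {perm point} => s (0, false))) => -[i s].
  rewrite permM perm_aX.
  by case: s; rewrite ?perm1 ?expg1 ?permE /= ?oppr0 add0r natr_Zp.
have card_point : #|{: point}| = (4 * n)%N.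
  rewrite card_prod card_bool card_ord Zp_cast; first by rewrite mulnAC.
  by rewrite -[2%N]/(1 * 2)%N leq_mul.
rewrite -card_point -(card_codom f_inj).
apply/subset_leq_card/subsetP => _ /codomP[p ->].
by rewrite groupM // groupX // ?mem_gen // inE ?cycle_id ?orbT.
Qed.

End QuaternionModel.

(** * From the presentation to a pair of generators *)

Record quaternion_pair (gT : finGroupType) (n : nat) (a b : gT) : Prop :=
  QuaternionPair {
    quaternion_order : #[a]%g = (2 * n)%N;
    quaternion_notin : (b \notin <[a]>)%g;
    quaternion_square : (b ^+ 2 = a ^+ n)%g;
    quaternion_conj : (a ^ b = a^-1)%g;
    quaternion_card : (#|gT| = 4 * n)%N;
    quaternion_coset : forall x, (x \notin <[a]> -> b^-1 * x \in <[a]>)%g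
  }.

(** The relations bound orders from above: G is the union of A and bA, with |A| at most 2n. The
    permutation model is a quotient of G, so |G| is at least 4n and both bounds are attained. *)
Lemma gen_quaternion_pair (gT : finGroupType) n :
    (1 < n)%N -> gen_quaternion [set: gT] n ->
  exists a b : gT, quaternion_pair n a b.
Proof.
move=> n_gt1 isoG.
have /existsP[[a b] /= /eqP[defG an bn ab]] := isoGrp_hom isoG.
have [pan pbn pab] := perm_relations n_gt1.
have oG : (4 * n <= #|gT|)%N.
  apply: leq_trans (card_perm_group n_gt1) _; rewrite -cardsT.
  (* By [isoG], a group is an image of G as soon as it has generators satisfying the relations. *)
  apply: dvdn_leq => //; apply: card_homg; rewrite isoG.
  apply/existsP; exists (perm_a n, perm_b n).
  by rewrite /= pan pbn pab !eqxx.
have nab : (b \in 'N(<[a]>))%g.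
  rewrite -groupV; apply/normP; rewrite -cycleJ conjgE invgK mulgA ab.
  by rewrite cycleV.
have defC : ([set: gT] = <[b]> * <[a]>)%g.
  by rewrite -defG joingC norm_joinEl // cycle_subG.
have b2a : (b ^+ 2 \in <[a]>)%g by rewrite bn mem_cycle.
have oa : (#[a]%g <= 2 * n)%N.
  apply: dvdn_leq; first by rewrite mul2n double_gt0 ltnW.
  by rewrite order_dvdn an.
have GE : [set: gT] = (<[a]> :|: b *: <[a]>)%g.
  apply/esym/setP => y; rewrite in_setT; have := in_setT y.
  rewrite defC => /mulsgP[_ x /cycleP[j ->] Ax ->].
  rewrite -(odd_double_half j) expgD -mul2n expgM -mulgA in_setU mem_lcoset.
  have Bx : ((b ^+ 2) ^+ j./2 * x \in <[a]>)%g := groupM (groupX _ b2a) Ax.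
  by case: (odd j); rewrite ?expg1 ?mulKg ?expg0 ?mul1g Bx ?orbT.
have oGle : (#|gT| <= #[a]%g + #|(b *: <[a]>)%g|)%N.
  by rewrite -cardsT GE leq_card_setU.
rewrite card_lcoset -orderE addnn in oGle.
have oaE : #[a]%g = (2 * n)%N.
  by apply/eqP; rewrite eqn_leq oa -leq_double -mul2n mulnA (leq_trans oG).
have oGE : #|gT| = (4 * n)%N.
  by apply/eqP; rewrite eqn_leq oG andbT (leq_trans oGle) // oaE -mul2n mulnA.
exists a, b; split=> // [||{oGle}x nAx].
- apply/negP => Ab.
  suff : (#|gT| <= 2 * n)%N by rewrite oGE leq_pmul2r ?(ltnW n_gt1).
  rewrite -oaE -cardsT; apply/subset_leq_card; rewrite GE subUset subxx /=.
  by apply/subsetP => y; rewrite mem_lcoset groupMl ?groupV.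
- by apply: invg_inj; rewrite invgK -conjVg -ab conjgE !mulgA mulVg mul1g mulgKV.
have := in_setT x; rewrite GE in_setU (negPf nAx) mem_lcoset.
by [].
Qed.

(** * Powers, centralizers and roots in the generalized quaternion group *)

Section QuaternionStructure.

Variables (gT : finGroupType) (n : nat) (a b : gT).
Hypothesis qab : quaternion_pair n a b.

Local Notation A := <[a]>%g.
Local Notation z := (a ^+ n)%g.

Let oa : #[a]%g = (2 * n)%N := quaternion_order qab.
Let nAb : b \notin A := quaternion_notin qab.
Let b2 : (b ^+ 2)%g = z := quaternion_square qab.
Let ab : (a ^ b)%g = a^-1%g := quaternion_conj qab.
Let oG : #|gT| = (4 * n)%N := quaternion_card qab.
Let Acoset x : x \notin A -> (b^-1 * x)%g \in A :=
  @quaternion_coset _ _ _ _ qab x.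

(** x is b times an element of the abelian group A, and b inverts A. *)
Lemma conj_outside x y : x \notin A -> y \in A -> (y ^ x = y^-1)%g.
Proof.
move=> /Acoset Ax /[dup] Ay /cycleP[i def_y].
rewrite -(mulKVg b x) conjgM (_ : y ^ b = y^-1)%g; last first.
  by rewrite def_y conjXg ab expgVn.
by apply/conjg_fixP/commgP; apply: (centsP (cycle_abelian a)); rewrite ?groupV.
Qed.

Lemma mul_outside x y : x \notin A -> y \notin A -> (x * y)%g \in A.
Proof.
move=> /Acoset Ax /Acoset Ay; rewrite -(mulKVg b y) mulgA groupMr //.
rewrite -(mulKVg b x) -mulgA [((b^-1 * x) * b)%g]conjgC mulgA -expg2 b2.
by rewrite conj_outside // groupM ?groupV ?mem_cycle.
Qed.

Lemma square_outside x : x \notin A -> (x ^+ 2 = z)%g.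
Proof.
move=> /Acoset Ax; rewrite -(mulKVg b x) expg2 -mulgA.
rewrite [((b^-1 * x) * _)%g]mulgA [((b^-1 * x) * b)%g]conjgC conj_outside //.
by rewrite -mulgA mulVg mulg1 -expg2 b2.
Qed.

Lemma z_mem : z \in A. Proof. exact: mem_cycle. Qed.

Lemma z_square : (z ^+ 2 = 1)%g.
Proof. by rewrite -expgM mulnC -oa expg_order. Qed.

Lemma z_inv : (z^-1 = z)%g.
Proof. by apply/eqP; rewrite eq_invg_mul -expg2 z_square. Qed.

Lemma z_central x : commute z x.
Proof.
have [Ax|nAx] := boolP (x \in A); last first.
  by apply/commgP/conjg_fixP; rewrite (conj_outside nAx) ?z_mem // z_inv.
by apply: (centsP (cycle_abelian a)); rewrite ?z_mem.
Qed.

Lemma n_gt0 : (0 < n)%N.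
Proof. by have := order_gt0 a; rewrite oa mul2n double_gt0. Qed.

Lemma z_neq1 : (z != 1)%g.
Proof.
rewrite -order_dvdn oa; apply/negP => /(dvdn_leq n_gt0).
by rewrite leqNgt ltn_Pmull ?n_gt0.
Qed.

Lemma involution_mem y : y \in A -> (y ^+ 2 = 1)%g -> y = 1%g \/ y = z.
Proof.
move=> /cyclePmin[i lti ->] /eqP; rewrite -expgM -order_dvdn oa mulnC.
rewrite dvdn_pmul2r // => /dvdnP[q def_i]; move: lti.
rewrite def_i oa ltn_pmul2r ?n_gt0 //.
by case: q {def_i} => [|[|//]] _; [left | right]; rewrite ?mul1n.
Qed.

Lemma expg_outside_even x m : x \notin A -> ~~ odd m -> (x ^+ m = z ^+ m./2)%g.
Proof.
move=> nAx em; rewrite -[in LHS](even_halfK em) -mul2n expgM.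
by rewrite square_outside.
Qed.

Lemma expg_outside_odd x m : x \notin A -> odd m -> (x ^+ m = x * z ^+ m./2)%g.
Proof.
move=> nAx om; rewrite -[in LHS](odd_double_half m) om expgS -mul2n expgM.
by rewrite square_outside.
Qed.

Lemma zX_square k : (z ^+ k * z ^+ k = 1)%g.
Proof. by rewrite -expgD addnn -mul2n expgM z_square expg1n. Qed.

Lemma zX_inv k : ((z ^+ k)^-1 = z ^+ k)%g.
Proof. by rewrite -expgVn z_inv. Qed.

Lemma zX_mem k : (z ^+ k \in A)%g. Proof. exact/groupX/z_mem. Qed.

Lemma zX_central k x : commute (z ^+ k)%g x.
Proof. exact/commute_sym/commuteX/commute_sym/z_central. Qed.

Lemma card_outside : #|[predC A]| = (2 * n)%N.
Proof.
have := cardC (mem A); rewrite oG -orderE oa -[4%N]/(2 + 2)%N mulnDl.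
by move/addnI.
Qed.

(** The centralizer lies in <u>, which contains z = u^2: an element of A commuting with u is its own
    inverse, hence 1 or z, and for y outside A this applies to y u. *)
Lemma cent1_outside_dvd u : u \notin A -> (#|('C[u])%g| %| 4)%N.
Proof.
move=> nAu; have u4 : (u ^+ 4 = 1)%g.
  by rewrite (expgM u 2 2) (square_outside nAu) z_square.
apply: (@dvdn_trans #[u]%g); last by rewrite order_dvdn u4.
have zu : (z \in <[u]>)%g by rewrite -(square_outside nAu) mem_cycle.
have centA y : y \in A -> commute u y -> (y \in <[u]>)%g.
  move=> Ay cuy; have /involution_mem[//||->//] : (y ^+ 2 = 1)%g.
    rewrite expg2; apply/eqP; rewrite -eq_invg_mul; apply/eqP.
    by rewrite -(conj_outside nAu Ay); apply/conjg_fixP/commgP/commute_sym.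
  by move=> ->.
apply: cardSg; apply/subsetP => y /cent1P cuy.
have [Ay|nAy] := boolP (y \in A); first exact: centA.
rewrite -(groupMr _ (cycle_id u)) centA ?mul_outside //.
exact: commuteM.
Qed.

Lemma cent1_inside_dvd u :
  u \in A -> (u ^+ 2 != 1)%g -> (#|('C[u])%g| %| 2 * n)%N.
Proof.
move=> Au u2; rewrite -oa; apply: cardSg; apply/subsetP => y /cent1P cuy.
apply/negPn/negP => nAy; case/eqP: u2; rewrite expg2; apply/eqP.
rewrite -eq_invg_mul -(conj_outside nAy Au); apply/eqP.
exact/conjg_fixP/commgP.
Qed.

(** If not empty, the root set is a coset of the m-torsion of A, which contains z because m is
    even. *)
Lemma card_roots_even m c :
  ~~ odd m -> (2 %| #|[set x in A | x ^+ m == c]%g|)%N.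
Proof.
move=> em; have [->|[x0]] := set_0Vmem [set x in A | x ^+ m == c]%g.
  by rewrite cards0.
rewrite inE => /andP[Ax0 /eqP x0m].
pose L := Group (group_Ldiv m (cycle_abelian a)).
rewrite (_ : [set x in A | _] = L :* x0)%g.
  rewrite card_rcoset -(_ : #[z]%g = 2%N); last first.
    by apply: nt_prime_order; rewrite ?z_square ?z_neq1.
  apply: order_dvdG; rewrite inE z_mem inE -[m]even_halfK // -mul2n expgM.
  by rewrite z_square expg1n eqxx.
apply/setP => x; rewrite mem_rcoset !inE groupMr ?groupV //.
apply: andb_id2l => Ax; rewrite expgMn ?expgVn ?x0m -?eq_mulgV1 //.
by apply: (centsP (cycle_abelian a)); rewrite ?groupV.
Qed.

(** * Sums over the solutions x of (u x^-1)^m x^m = 1 *)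

Section RootSums.

Variables (K : pzRingType) (T : gT -> K) (m : nat).

Local Notation root_sum u :=
  (\sum_x ((u * x^-1) ^+ m * x ^+ m == 1)%g%:R * T (x ^+ m)%g).

(** For x in A everything commutes and (u x^-1)^m x^m = u^m. For x outside A the element u x^-1 is
    outside too; the powers of z cancel and leave 1 if m is even, u if m is odd. *)
Lemma root_sum_inside u : u \in A ->
  root_sum u = ((u ^+ m)%g == 1%g)%:R * \sum_(x in A) T (x ^+ m)%g
    + (~~ odd m || (u == 1%g))%:R * \sum_(x | x \notin A) T (x ^+ m)%g.
Proof.
move=> Au; rewrite (bigID (mem A)) /= !mulr_sumr.
congr (_ + _); apply: eq_bigr => x Ax; congr (_%:R * _); congr nat_of_bool.
  rewrite expgMn; last first.
    by apply: (centsP (cycle_abelian a)); rewrite ?groupV.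
  by rewrite expgVn mulgKV.
have nAux : (u * x^-1)%g \notin A by rewrite groupMl ?groupV.
case: (boolP (odd m)) => [om|em] /=.
  rewrite (expg_outside_odd nAux) // (expg_outside_odd Ax) // mulgA.
  rewrite -(mulgA (u * _)%g) zX_central.
  by rewrite mulgA mulgKV -mulgA zX_square mulg1.
by rewrite (expg_outside_even nAux) // (expg_outside_even Ax) // zX_square eqxx.
Qed.

(** Exactly one of x and u x^-1 lies outside A, as do its odd powers, so the product of m-th powers
    is never 1. *)
Lemma root_sum_outside_odd u : u \notin A -> odd m -> root_sum u = 0.
Proof.
move=> nAu om; apply: big1 => x _; case: eqP => [uxm|]; last by rewrite mul0r.
case/negP: nAu; have [Ax|nAx] := boolP (x \in A).
  have: ((u * x^-1) ^+ m * x ^+ m \in A)%g by rewrite uxm group1.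
  rewrite (groupMr _ (groupX m Ax)); apply: contraLR => nAu.
  have nAux : (u * x^-1)%g \notin A by rewrite groupMr ?groupV.
  by rewrite expg_outside_odd // groupMr ?zX_mem.
have: ((u * x^-1) ^+ m * x ^+ m \in A)%g by rewrite uxm group1.
rewrite (expg_outside_odd nAx) // mulgA (groupMr _ (zX_mem _)).
apply: contraLR => nAu; rewrite groupMl // groupX // mul_outside //.
by rewrite groupV.
Qed.

(** One of x and u x^-1 lies outside A and has m-th power [z ^+ m./2], so the other must be a root
    of the same element; the two choices give the factor 2. *)
Lemma root_sum_outside_even u : u \notin A -> ~~ odd m ->
  root_sum u
    = (#|[set x in A | x ^+ m == z ^+ m./2]%g| * 2)%:R * T (z ^+ m./2)%g.
Proof.
move=> nAu em; set N := #|_|.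
have sumN : \sum_(x in A) (x ^+ m == z ^+ m./2)%g%:R = N%:R :> K.
  by rewrite -natr_sum -big_mkcondr /= sum1_card /N cardsE.
rewrite natrM mulr_natr mulr2n mulrDl -[X in X * _ + _]sumN -sumN !mulr_suml.
rewrite (bigID (mem A)) /=; congr (_ + _).
  apply: eq_bigr => x Ax.
  have nAux : (u * x^-1)%g \notin A by rewrite groupMr ?groupV.
  rewrite (expg_outside_even nAux) // -(zX_inv m./2) -eq_mulVg1 zX_inv eq_sym.
  by case: eqP => [->|]; rewrite ?mul0r.
(* The new variable y = u x^-1 runs over A when x runs over the complement. *)
rewrite (reindex_inj (inj_comp (mulIg u) (@invg_inj _))) /=.
apply: eq_big => [y|y nAyu].
  apply/idP/idP => [|Ay]; last by rewrite groupMl ?groupV.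
  by apply: contraR => nAy; rewrite mul_outside ?groupV.
rewrite (expg_outside_even nAyu) // invMg invgK mulKVg.
by rewrite -(zX_inv m./2) -eq_mulgV1 zX_inv.
Qed.

End RootSums.

End QuaternionStructure.

(** * Integral scalars, and traces of idempotent matrices *)

Definition int_valued (K : pzRingType) (x : K) := exists k : int, x = k%:~R.

Section IntValued.

Variable K : pzRingType.
Implicit Types x y : K.

Lemma int_valued_nat k : int_valued (k%:R : K).
Proof. by exists k%:Z. Qed.

Lemma int_valuedD x y :
  int_valued x -> int_valued y -> int_valued (x + y).
Proof. by move=> [k ->] [l ->]; exists (k + l); rewrite intrD. Qed.

Lemma int_valuedM x y :
  int_valued x -> int_valued y -> int_valued (x * y).
Proof. by move=> [k ->] [l ->]; exists (k * l); rewrite intrM. Qed.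

Lemma int_valued_sum (I : finType) (P : pred I) (F : I -> K) :
  (forall i, P i -> int_valued (F i)) ->
  int_valued (\sum_(i | P i) F i).
Proof.
move=> intF; apply: big_ind => //; first exact: (int_valued_nat 0).
exact: int_valuedD.
Qed.

End IntValued.

Lemma mxscaleAl (K : fieldType) d c (X Y : 'M[K]_d) : c *: (X * Y) = c *: X * Y.
Proof. by rewrite -!mulmxE scalemxAl. Qed.

Lemma mxscaleAr (K : fieldType) d c (X Y : 'M[K]_d) : c *: (X * Y) = X * (c *: Y).
Proof. by rewrite -!mulmxE scalemxAr. Qed.

Section Idempotents.

Variables (K : numFieldType) (d : nat).
Implicit Types E M N B : 'M[K]_d.

(** A rank factorisation of E; it turns X into R X C, the restriction of X to the image of E. *)
Lemma idempotent_factor E : E * E = E ->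
  exists R C, R *m C = 1%:M :> 'M_(\rank E) /\ C *m R = E.
Proof.
rewrite -mulmxE => idE; exists (row_base E), (col_base E).
split; last exact: mulmx_base.
apply: (row_free_inj (row_base_free E)); rewrite /= mul1mx -mulmxA.
apply: (row_full_inj (col_base_full E)).
by rewrite mulmx_base mulmxA mulmx_base.
Qed.

Lemma idempotent_trace E : E * E = E -> \tr E = (\rank E)%:R.
Proof.
move=> /idempotent_factor[R [C [RC CR]]].
by rewrite -{1}CR mxtrace_mulC RC mxtrace1.
Qed.

(* Restricted to the image of E, N is invertible and conjugate to its         *)
(* opposite, so that det N = (-1) ^ (rank E) det N.                           *)
Lemma anticommuting_rank_even E N M B B' :
    E * E = E -> E * N = N * E -> E * B = B * E -> B * B' = 1 ->
    B * N * B' = - N -> E = N * M ->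
  ~~ odd (\rank E).
Proof.
move=> idE cEN cEB BB' BNB' defE.
have [R [C [RC CR]]] := idempotent_factor idE.
pose res X := R *m X *m C.
have RE : R *m E = R by rewrite -[RHS]mul1mx -RC -mulmxA CR.
(* Commutation of the left factor alone is enough: R X (C R) Y C = R E X Y C, and R E = R. *)
have resM X Y : E * X = X * E -> res (X * Y) = res X *m res Y.
  rewrite -!mulmxE => cEX.
  by rewrite /res !mulmxA -(mulmxA (R *m X) C) CR -(mulmxA R X E) -cEX mulmxA RE.
have res1 : res 1 = 1%:M by rewrite /res mulmx1.
have resE : res E = 1%:M by rewrite /res RE.
have detN0 : \det (res N) != 0.
  have: \det (res N) * \det (res M) = 1.
    by rewrite -det_mulmx -resM // -defE resE det1.
  by move/eqP; apply: contraTneq => ->; rewrite mul0r eq_sym oner_eq0.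
have detB : \det (res B) * \det (res B') = 1.
  by rewrite -det_mulmx -resM // BB' res1 det1.
have: \det (res (B * N * B')) = \det (res N).
  rewrite -mulrA !resM // ?mulrA ?cEB -?mulrA ?cEN //.
  by rewrite !det_mulmx mulrCA detB mulr1.
rewrite BNB' /res mulmxN mulNmx -scaleN1r detZ -/(res N) => /eqP.
rewrite -subr_eq0 -[X in _ - X]mul1r -mulrBl mulf_eq0 (negPf detN0) orbF.
rewrite subr_eq0 -signr_odd; case: odd => //.
by rewrite expr1 eq_sym -addr_eq0 -mulr2n pnatr_eq0.
Qed.

(** [Q] projects onto the +1 eigenspace of N in the image of E, so tr (E N) = 2 rank Q - rank E. *)
Lemma involution_trace E N : E * E = E -> E * N = N * E -> E * (N * N) = E ->
  exists l : int, \tr (E * N) = \tr E + (l * 2)%:~R.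
Proof.
move=> idE cEN ENN; pose Q := 2^-1 *: (E + E * N).
have idQ : Q * Q = Q.
  rewrite /Q -mxscaleAl -mxscaleAr; congr (_ *: _).
  have ENE : E * N * E = E * N by rewrite -mulrA -cEN mulrA idE.
  rewrite mulrDl !mulrDr idE mulrA idE ENE mulrA ENE -mulrA ENN [E * N + E]addrC.
  by rewrite -mulr2n -scaler_nat scalerA mulVf ?scale1r // pnatr_eq0.
exists (Posz (\rank Q) - Posz (\rank E)).
rewrite intrM intrD mulrDl intrN mulNr -!pmulrn -!idempotent_trace //.
rewrite /Q mxtraceZ mulrAC mulVf ?pnatr_eq0 // mul1r mxtraceD.
by ring.
Qed.

End Idempotents.

(** * Traces of e rho(x^m) for a multiplicative map rho and an idempotent e *)

Section QuaternionTraces.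

Variables (K : numFieldType) (d : nat) (gT : finGroupType) (n : nat) (a b : gT).
Hypothesis qab : quaternion_pair n a b.

Local Notation A := <[a]>%g.
Local Notation z := (a ^+ n)%g.

Let oa : #[a]%g = (2 * n)%N := quaternion_order qab.

Variables (rho : gT -> 'M[K]_d) (e : 'M[K]_d).
Hypotheses (rho1 : rho 1%g = 1) (rhoM : {morph rho : x y / (x * y)%g >-> x * y}).
Hypothesis ee : e * e = e.

(* The projector onto the fixed space of a ^+ m. *)
Definition power_average m : 'M[K]_d :=
  (2 * n)%:R^-1 *: \sum_(x in A) rho (x ^+ m)%g.

Lemma order_neq0 : (2 * n)%:R != 0 :> K.
Proof. by rewrite pnatr_eq0 -oa -lt0n. Qed.

Lemma rhoX x k : rho (x ^+ k)%g = rho x ^+ k.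
Proof. by elim: k => [|k IHk]; rewrite ?expg0 // expgS exprS rhoM IHk. Qed.

Lemma average_scale X :
  (2 * n)%:R^-1 *: \sum_(x in A) X = X :> 'M[K]_d.
Proof.
by rewrite sumr_const -orderE oa -scaler_nat scalerA mulVf ?order_neq0 ?scale1r.
Qed.

Lemma average_mull m y :
  y \in A -> rho (y ^+ m)%g * power_average m = power_average m.
Proof.
move=> Ay; rewrite /power_average -mxscaleAr mulr_sumr; congr (_ *: _).
rewrite [RHS](reindex_inj (mulgI y)) /=; apply: eq_big => x.
  by rewrite groupMl.
move=> Ax; rewrite -rhoM expgMn //.
exact: (centsP (cycle_abelian a)).
Qed.

Lemma average_comm m y : rho y * power_average m = power_average m * rho y.
Proof.
rewrite /power_average -mxscaleAr -mxscaleAl mulr_sumr mulr_suml; congr (_ *: _).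
have nAy : y \in 'N(A)%g.
  have [Ay|nAy] := boolP (y \in A); first exact: (subsetP (normG _)).
  apply/normP/eqP; rewrite eqEcard cardJg leqnn andbT.
  apply/subsetP => _ /imsetP[x Ax ->].
  by rewrite (conj_outside qab nAy) ?groupV.
rewrite [LHS](reindex_inj (conjg_inj y)) /=; apply: eq_big => x.
  by rewrite memJ_norm.
by move=> _; rewrite -!rhoM -conjXg -conjgC.
Qed.

Lemma average_idem m : power_average m * power_average m = power_average m.
Proof.
rewrite -{3}[power_average m]average_scale {1}/power_average -mxscaleAl.
by rewrite mulr_suml; congr (_ *: _); apply: eq_bigr => y; apply: average_mull.
Qed.

(** Vectors fixed by A are in particular fixed by a^m. *)
Lemma average_absorb m : power_average m * power_average 1 = power_average 1.
Proof.
rewrite -{2}[power_average 1]average_scale {1}/power_average -mxscaleAl.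
rewrite mulr_suml; congr (_ *: _); apply: eq_bigr => y Ay.
by rewrite -[X in X * _]/(rho ((y ^+ m) ^+ 1)%g) average_mull ?groupX.
Qed.

Lemma comm_average X m : (forall y, y \in A -> X * rho y = rho y * X) ->
  X * power_average m = power_average m * X.
Proof.
move=> cX; rewrite /power_average -mxscaleAr -mxscaleAl mulr_sumr mulr_suml.
by congr (_ *: _); apply: eq_bigr => x Ax; rewrite cX ?groupX.
Qed.

Lemma average_comm_average m k :
  power_average m * power_average k = power_average k * power_average m.
Proof. by apply: comm_average => y _; rewrite average_comm. Qed.

Lemma trace_average f m :
  \sum_(x in A) \tr (f * rho (x ^+ m)%g) = (2 * n)%:R * \tr (f * power_average m).
Proof.
rewrite /power_average -mxscaleAr mxtraceZ mulrA mulfV ?order_neq0 // mul1r.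
by rewrite mulr_sumr raddf_sum.
Qed.

Lemma int_valued_trace_average m :
  (forall y, y \in A -> e * rho y = rho y * e) ->
  int_valued (\tr (e * power_average m)).
Proof.
move=> ce.
have ceP := comm_average m ce.
have idP : e * power_average m * (e * power_average m) = e * power_average m.
  by rewrite {2}ceP mulrA -(mulrA e) average_idem -mulrA -ceP mulrA ee.
by rewrite (idempotent_trace idP); apply: int_valued_nat.
Qed.

(** Conjugation by rho(b) negates [N]. Writing a projector as [N * M] certifies that [N] is
    invertible on its image when the two commute. *)
Let N := rho a - rho a^-1%g.

(** a^(2i) - 1 = (a - a^-1) a (1 + a^2 + ... + a^(2i-2)). *)
Lemma square_divides y : y \in A -> exists M, rho (y ^+ 2)%g - 1 = N * M.
Proof.
case/cycleP => i ->; exists (rho a * \sum_(j < i) rho (a ^+ 2)%g ^+ j).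
rewrite -expgM mulnC expgM [X in X - 1]rhoX subrX1 mulrA; congr (_ * _).
by rewrite mulrBl -!rhoM mulVg rho1 expgS expg1.
Qed.

Lemma trace_even E M : E * E = E -> (forall y, E * rho y = rho y * E) ->
  E = N * M -> exists k, \tr E = (k * 2)%:R.
Proof.
move=> idE cE defE.
have : ~~ odd (\rank E).
  apply: (anticommuting_rank_even (B := rho b) (B' := rho b^-1%g) idE _ _ _ _ defE).
  - by rewrite mulrBl mulrBr !cE.
  - exact: cE.
  - by rewrite -rhoM mulgV.
  - rewrite /N mulrBr mulrBl -!rhoM opprB.
    have nAb' : b^-1%g \notin A by rewrite groupV (quaternion_notin qab).
    have conjb x : x \in A -> (b * x * b^-1 = x^-1)%g.
      by move=> Ax; rewrite -(conj_outside qab nAb' Ax) conjgE invgK mulgA.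
    by rewrite !conjb ?groupV ?cycle_id // invgK.
move=> evenE; exists (\rank E)./2.
by rewrite idempotent_trace // muln2 even_halfK.
Qed.

Hypothesis ce : forall y, e * rho y = rho y * e.

Lemma trace_divisible_even P :
    P * P = P -> (forall y, P * rho y = rho y * P) -> e * P = P * e ->
    (exists M, P = N * M) ->
  exists k, \tr (e * P) = (k * 2)%:R.
Proof.
move=> idP cP ceP [M defP].
apply: (trace_even (M := e * M)) => [|y|].
- by rewrite {2}ceP mulrA -(mulrA e) idP -mulrA -ceP mulrA ee.
- by rewrite mulrA -ce -mulrA cP mulrA.
- by rewrite defP mulrA mulrBr !ce -mulrBl mulrA.
Qed.

Lemma sum_divides (F : gT -> 'M[K]_d) :
    (forall x, x \in A -> exists M, F x = N * M) ->
  exists M, (2 * n)%:R^-1 *: \sum_(x in A) F x = N * M.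
Proof.
move=> divF.
suff [M ->] : exists M, \sum_(x in A) F x = N * M.
  by exists ((2 * n)%:R^-1 *: M); rewrite mxscaleAr.
apply: (big_ind (fun S => exists M, S = N * M)) => //.
  by exists 0; rewrite mulr0.
by move=> _ _ [M1 ->] [M2 ->]; exists (M1 + M2); rewrite mulrDr.
Qed.

(** The projector is the average over A of 1 - x^m, and x^m is the square of x^(m/2), so each term
    is divisible by [N]. *)
Lemma trace_defect_even m : ~~ odd m ->
  exists k, \tr (e * (1 - power_average m)) = (k * 2)%:R.
Proof.
move=> em; apply: trace_divisible_even => [|y||].
- by rewrite mulrBl mul1r mulrBr mulr1 average_idem subrr subr0.
- by rewrite mulrBl mulrBr mul1r mulr1 average_comm.
- by rewrite mulrBl mulrBr mul1r mulr1 (comm_average _ (fun y _ => ce y)).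
rewrite -[1]average_scale /power_average -scalerBr -sumrB.
apply: sum_divides => x Ax; have [M eqM] := square_divides (groupX m./2 Ax).
by exists (- M); rewrite mulrN -eqM opprB -expgM muln2 even_halfK.
Qed.

(** The projector is the average over A of x^m - x = (x^(m-1) - 1) x, where m - 1 is even. *)
Lemma trace_defect_odd m : odd m ->
  exists k, \tr (e * (power_average m - power_average 1)) = (k * 2)%:R.
Proof.
move=> om; have absorb := average_absorb m.
apply: trace_divisible_even => [|y||].
- rewrite mulrBl mulrBr average_idem absorb mulrBr average_comm_average absorb.
  by rewrite average_idem subrr subr0.
- by rewrite mulrBl mulrBr !average_comm.
- by rewrite mulrBl mulrBr !(comm_average _ (fun y _ => ce y)).
rewrite /power_average -scalerBr -sumrB.
apply: sum_divides => x Ax; have [M eqM] := square_divides (groupX m./2 Ax).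
exists (M * rho x); rewrite mulrA -eqM mulrBl mul1r -rhoM -expgM muln2 -expgSr.
by rewrite odd_halfK // prednK ?odd_gt0.
Qed.

Lemma outside_trace_sum :
  \sum_(x | x \notin A) \tr (e * rho x)
    = (2 * n)%:R * \tr (e * power_average 1 * rho b).
Proof.
have nAb := quaternion_notin qab.
rewrite -mulrA -average_comm mulrA -trace_average (reindex_inj (mulgI b)) /=.
apply: eq_big => [x|x _]; last by rewrite rhoM mulrA expg1.
apply/idP/idP => [|Ax]; last by rewrite groupMr.
by apply: contraR => nAx; apply: mul_outside qab _ _ _ _.
Qed.

(** A and its complement each contribute 2n times an integer. Modulo 2 both integers are tr (e P)
    with P = [power_average 1] if m is odd, and tr e if m is even. *)
Lemma power_sum_divisible m :
  exists k : int, \sum_x \tr (e * rho (x ^+ m)%g) = (4 * n)%:R * k%:~R.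
Proof.
have eP k : e * power_average k * (e * power_average k) = e * power_average k.
  rewrite {2}(comm_average k (fun y _ => ce y)) mulrA -(mulrA e) average_idem.
  by rewrite -mulrA -(comm_average k (fun y _ => ce y)) mulrA ee.
suff [k ->] : exists k : int,
    \sum_x \tr (e * rho (x ^+ m)%g) = (2 * n)%:R * (2 * k%:~R).
  by exists k; rewrite mulrA -natrM [(2 * n * 2)%N]mulnAC.
rewrite (bigID (mem A)) /= trace_average.
have [om|em] := boolP (odd m).
  have -> : \sum_(x | x \notin A) \tr (e * rho (x ^+ m)%g)
      = \sum_(x | x \notin A) \tr (e * rho x).
    rewrite [RHS](reindex_inj (mulIg (z ^+ m./2)%g)) /=.
    apply: eq_big => [x|x nAx]; first by rewrite groupMr ?zX_mem.
    by rewrite (expg_outside_odd qab).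
  have [k] := trace_defect_odd om; rewrite mulrBr raddfB /= => /eqP.
  rewrite subr_eq => /eqP ->; rewrite outside_trace_sum -mulrDr.
  have [|||l ->] := @involution_trace _ _ (e * power_average 1) (rho b).
  - exact: eP.
  - by rewrite -mulrA -average_comm mulrA ce mulrA.
  (* b^2 lies in A, hence acts as the identity on the image of [power_average 1]: there b is an
     involution. *)
  - rewrite -rhoM -expg2 (quaternion_square qab) -mulrA -average_comm.
    by rewrite -[X in rho X]expg1 average_mull ?mem_cycle.
  exists (Posz k + Posz (\rank (e * power_average 1)%R) + l).
  rewrite !intrD -!pmulrn -idempotent_trace // natrM intrM -pmulrn.
  by congr (_ * _); ring.
rewrite (eq_bigr (fun=> \tr (e * rho (z ^+ m./2)%g))); last first.
  by move=> x nAx; rewrite (expg_outside_even qab).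
rewrite sumr_const (card_outside qab).
have [k] := trace_defect_even em; rewrite mulrBr mulr1 raddfB /= => /eqP.
rewrite subr_eq [X in _ == X]addrC -subr_eq => /eqP <-.
have ww : rho (z ^+ m./2)%g * rho (z ^+ m./2)%g = 1.
  by rewrite -rhoM (zX_square qab) rho1.
have [|l ->] := @involution_trace _ _ e (rho (z ^+ m./2)%g) ee (ce _).
  by rewrite ww mulr1.
exists (Posz (\rank e) + l - k%:Z).
rewrite -[X in _ + X = _]mulr_natl -mulrDr intrB intrD -!pmulrn -idempotent_trace //.
by rewrite natrM intrM -pmulrn; congr (_ * _); ring.
Qed.

End QuaternionTraces.

(** * Divisibility of the root sums by the order of the centralizer *)

Lemma int_valued_dvd (K : pzRingType) (c N : nat) (x : K) :
    (c %| N)%N -> int_valued x ->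
  exists k : int, N%:R * x = c%:R * k%:~R.
Proof.
move=> /dvdnP[q ->] [k ->]; exists (Posz q * k).
by rewrite mulnC natrM -mulrA intrM -pmulrn.
Qed.

(** The idempotent e is known to commute with C(u) only. This group always contains z, contains A
    when u is in A, and is everything when u is central, which is what the trace lemmas need in the
    three cases. *)
Lemma root_sum_divisible (K : numFieldType) d (gT : finGroupType) n (a b : gT)
    (qab : quaternion_pair n a b) (rho : gT -> 'M[K]_d) (e : 'M[K]_d) (u : gT) m :
    rho 1%g = 1 -> {morph rho : x y / (x * y)%g >-> x * y} -> e * e = e ->
    (forall y, y \in 'C[u]%g -> e * rho y = rho y * e) ->
  exists k : int,
    \sum_x ((u * x^-1) ^+ m * x ^+ m == 1)%g%:R * \tr (e * rho (x ^+ m)%g)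
      = #|('C[u])%g|%:R * k%:~R.
Proof.
move=> rho1 rhoM ee ce; pose T x := \tr (e * rho x).
have intT k : int_valued (T ((a ^+ n) ^+ k)%g).
  rewrite /T.
  have [||l ->] := @involution_trace _ _ e (rho ((a ^+ n) ^+ k)%g) ee.
  - by rewrite ce //; apply/cent1P; apply: zX_central qab _ _.
  - by rewrite -rhoM (zX_square qab) rho1 mulr1.
  exists (Posz (\rank e) + l * 2).
  by rewrite intrD -pmulrn -idempotent_trace.
have [Au|nAu] := boolP (u \in <[a]>%g); last first.
  have [om|em] := boolP (odd m).
    by exists 0; rewrite (root_sum_outside_odd qab T) // mulr0.
  rewrite (root_sum_outside_even qab T) //.
  apply: int_valued_dvd (intT _); apply: dvdn_trans (cent1_outside_dvd qab nAu) _.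
  by rewrite -[4%N]/(2 * 2)%N dvdn_mul // (card_roots_even qab).
rewrite (root_sum_inside qab T) //.
have [u2|u2] := eqVneq (u ^+ 2)%g 1%g; last first.
  rewrite (trace_average qab).
  have /negPf-> : u != 1%g by apply: contraNneq u2 => ->; rewrite expg1n.
  have [S intS ->] : exists2 S : K, int_valued S
     & (~~ odd m || false)%:R * (\sum_(x | x \notin <[a]>%g) T (x ^+ m)%g)
       = (2 * n)%:R * S.
    have [om|em] := boolP (odd m).
      exists 0; first exact: (int_valued_nat _ 0).
      by rewrite mulr0 mul0r.
    exists (T ((a ^+ n) ^+ m./2)%g) => //.
    rewrite (eq_bigr (fun=> T ((a ^+ n) ^+ m./2)%g)); last first.
      by move=> x nAx; rewrite (expg_outside_even qab).
    by rewrite mul1r sumr_const (card_outside qab) mulr_natl.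
  rewrite mulrCA -mulrDr; apply: int_valued_dvd (cent1_inside_dvd qab Au u2) _.
  apply: int_valuedD => //; apply: int_valuedM; first exact: int_valued_nat.
  apply: (int_valued_trace_average qab) => // y Ay; apply: ce.
  by apply/cent1P; apply: (centsP (cycle_abelian a)).
have centu y : y \in 'C[u]%g.
  apply/cent1P; have [->|->] := involution_mem qab Au u2.
    exact: commute1.
  exact/commute_sym/(z_central qab).
have -> : 'C[u]%g = [set: gT] by apply/setP => y; rewrite centu inE.
have [k] := power_sum_divisible qab rho1 rhoM ee (fun y => ce y (centu y)) m.
rewrite cardsT (quaternion_card qab) (bigID (mem <[a]>%g)) /= => def_k.
(* As u^2 = 1, if u^m is not 1 then m is odd and u is not 1, so both coefficients vanish. Otherwise
   m is even or u = 1, and the root sum is the full power sum. *)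
have [um|um] := eqVneq (u ^+ m)%g 1%g; last first.
  have [u1|_] := eqVneq u 1%g; first by rewrite u1 expg1n eqxx in um.
  have [om|em] := boolP (odd m); first by exists 0; rewrite !mul0r addr0 mulr0.
  case/eqP: um; rewrite -(even_halfK em) -mul2n expgM u2; exact: expg1n.
exists k; rewrite -def_k mul1r; have [om|em] := boolP (odd m); last by rewrite mul1r.
have -> : u = 1%g.
  by rewrite -um -[in RHS](odd_double_half m) om expgS -mul2n expgM u2 expg1n mulg1.
by rewrite eqxx mul1r.
Qed.

(** * Sweedler powers in the double *)

Section SweedlerPower.

Variables (K : fieldType) (gT : finGroupType).

Lemma big_tuple_cons (R : Type) (idx : R) (op : Monoid.com_law idx)
    (I : finType) k (F : k.+1.-tuple I -> R) :
  \big[op/idx]_t F t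
    = \big[op/idx]_i \big[op/idx]_(t : k.-tuple I) F (cons_tuple i t).
Proof.
rewrite pair_big /= (reindex (fun p : I * k.-tuple I => cons_tuple p.1 p.2)) //.
exists (fun t => (thead t, behead_tuple t)) => [[i t] _ | t _] /=.
  by rewrite theadE; congr (_, _); apply: val_inj.
by rewrite [RHS]tuple_eta; apply: val_inj.
Qed.

Lemma dsweedler_pow_succ k (f : drinfeld_double K gT) :
  dsweedler_pow k.+1 f
    = \sum_b \sum_c dcomul f (b, c)
        *: (dbasis K b.1 b.2 * dsweedler_pow k (dbasis K c.1 c.2)).
Proof.
rewrite /dsweedler_pow /dmul_tensor big_tuple_cons; apply: eq_bigr => b _.
under [RHS]eq_bigr => c _ do rewrite mulr_sumr scaler_sumr.
rewrite exchange_big /=; apply: eq_bigr => t _.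
rewrite ffunE theadE scaler_suml; apply: eq_bigr => c _.
rewrite big_cons -scalerAr scalerA; congr (_ * _ *: _).
by congr (dcomul_iter _ _ _); apply: val_inj.
Qed.

(** The iterated coproduct of [dbasis K g x] has factors [dbasis K u_i x] with u_1 ... u_m = g.
    Their product vanishes unless each u_(i+1) is x^-1 u_i x; with u_1 = u this forces g = (u
    x^-1)^m x^m, and the product is [dbasis K u (x ^+ m)]. *)
Lemma dsweedler_powE m (f : drinfeld_double K gT) :
  dsweedler_pow m f
    = \sum_u \sum_x f (((u * x^-1) ^+ m * x ^+ m)%g, x) *: dbasis K u (x ^+ m)%g.
Proof.
elim: m f => [|m IHm] f.
  rewrite [LHS](_ : _ = dcounit f *: 1); last first.
    rewrite /dsweedler_pow /dmul_tensor (bigD1 [tuple]) //= [X in _ + X]big1 ?addr0.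
      by rewrite ffunE big_nil.
    by move=> t /eqP[]; apply: tuple0.
  rewrite [1]/(done1 K gT) /done1 scaler_sumr; apply: eq_bigr => u _.
  rewrite [RHS](eq_bigr (fun x => f (1, x)%g *: dbasis K u 1)); last first.
    by move=> x _; rewrite !expg0 mulg1.
  rewrite -scaler_suml; congr (_ *: _); rewrite /dcounit.
  rewrite (eq_bigr (fun b => f (b.1, b.2) * (b.1 == 1%g)%:R)); last by case.
  rewrite -(pair_bigA _ (fun g x => f (g, x) * (g == 1%g)%:R)) /=.
  rewrite (bigD1 1%g) //= [X in _ + X]big1 ?addr0 => [|g /negPf ng1].
    by apply: eq_bigr => x _; rewrite eqxx mulr1.
  by apply: big1 => x _; rewrite ng1 mulr0.
rewrite dsweedler_pow_succ.
pose G u x := f ((u * x^-1) ^+ m.+1 * x ^+ m.+1, x)%g *: dbasis K u (x ^+ m.+1)%g.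
rewrite (pair_bigA _ G) /=; apply: eq_bigr => -[g x] _ /=.
rewrite (eq_bigr (fun c => \sum_(p : gT * gT)
    (dcomul f ((g, x), c) * (((p.1 * p.2^-1) ^+ m * p.2 ^+ m, p.2)%g == c)%:R)
      *: (dbasis K g x * dbasis K p.1 (p.2 ^+ m)%g))); last first.
  move=> c _; rewrite IHm pair_bigA mulr_sumr scaler_sumr /=.
  apply: eq_bigr => -[u y] _ /=.
  by rewrite dbasisE -surjective_pairing -scalerAr scalerA.
(* The coproduct repeats x in both factors, and multiplying by [dbasis K g x] on the left kills
   every degree other than x^-1 g x. *)
rewrite exchange_big /= (bigD1 ((x^-1 * g * x)%g, x)) //=.
rewrite [X in _ + X]big1 ?addr0 => [|[u y] /= nuy]; last first.
  apply: big1 => -[h w] _; rewrite dcomulE double_mulE.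
  have [eq_yw|_] := altP ((_, y) =P (h, w)); last by rewrite mulr0 scale0r.
  case: eq_yw => _ <-; have [eq_xy|_] := eqVneq x y; last by rewrite !mul0r scale0r.
  case: eqP => [def_g|_]; last by rewrite scale0r scaler0.
  by case/eqP: nuy; rewrite def_g -eq_xy !mulgA mulVg mul1g mulgKV.
rewrite (bigD1 (((x^-1 * g * x * x^-1) ^+ m * x ^+ m)%g, x)) //= eqxx mulr1.
rewrite [X in _ + X]big1 ?addr0 => [|c /negPf nc]; last first.
  by rewrite eq_sym nc mulr0 scale0r.
rewrite dcomulE eqxx mul1r mulgK double_mulE !mulgA mulgV mul1g mulgK eqxx.
rewrite scale1r /G -expgS; congr (f (_, _) *: _).
(* This turns g (x^-1 g)^m x^m into (g x^-1)^(m+1) x^(m+1). *)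
have -> : (x^-1 * g = (g * x^-1) ^ x)%g by rewrite conjgE mulgKV.
by rewrite -conjXg conjgE expgS (expgS x m) !mulgA.
Qed.

End SweedlerPower.

(** * Modules over the double, and the two indicators *)

Section DoubleModule.

Variables (K : numFieldType) (gT : finGroupType) (d : nat).
Variable W : {lrmorphism drinfeld_double K gT -> 'M[K]_d}.

Definition double_idempotent (g : gT) : 'M[K]_d := W (dbasis K g 1%g).

Definition double_group_action (x : gT) : 'M[K]_d := W (\sum_g dbasis K g x).

Local Notation e := double_idempotent.
Local Notation rho := double_group_action.

Lemma double_group_action1 : rho 1%g = 1.
Proof. exact: (rmorph1 W). Qed.

Lemma double_basis_action (g x y : gT) :
  dbasis K g x * (\sum_h dbasis K h y) = dbasis K g (x * y)%g.
Proof.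
rewrite mulr_sumr (bigD1 (g ^ x)%g) //= big1 ?addr0 => [|h nh].
  by rewrite double_mulE conjgE !mulgA mulgV mul1g mulgK eqxx scale1r.
rewrite double_mulE; case: eqP => [def_g|_]; last by rewrite scale0r.
by case/eqP: nh; rewrite def_g conjgE !mulgA mulVg mul1g mulgKV.
Qed.

Lemma double_group_actionM : {morph rho : x y / (x * y)%g >-> x * y}.
Proof.
move=> x y; rewrite -[RHS]rmorphM mulr_suml; congr (W _).
by apply: eq_bigr => g _; rewrite double_basis_action.
Qed.

Lemma double_idempotentK g : e g * e g = e g.
Proof. by rewrite -[LHS]rmorphM double_mulE mul1g invg1 mulg1 eqxx scale1r mul1g. Qed.

Lemma double_idempotent_action g x : e g * rho x = W (dbasis K g x).
Proof. by rewrite -[LHS]rmorphM double_basis_action mul1g. Qed.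

Lemma double_action_idempotent g x :
  rho x * e g = W (dbasis K (x * g * x^-1)%g x).
Proof.
rewrite -[LHS]rmorphM mulr_suml (bigD1 (x * g * x^-1)%g) //= big1 ?addr0 => [|h nh].
  by rewrite double_mulE eqxx scale1r mulg1.
by rewrite double_mulE (negPf nh) scale0r.
Qed.

(** The action of h^-1 carries the component of degree g onto that of degree g^h. *)
Lemma double_trace_conj g x h :
  \tr (e (g ^ h)%g * rho (x ^ h)%g) = \tr (e g * rho x).
Proof.
rewrite [(x ^ h)%g]conjgE double_group_actionM mulrA.
have -> : e (g ^ h)%g * rho h^-1%g = rho h^-1%g * e g.
  rewrite double_action_idempotent double_idempotent_action; congr (W (dbasis _ _ _)).
  by rewrite conjgE invgK mulgA.
rewrite -mulrA -mulmxE mxtrace_mulC mulmxE -mulrA double_group_actionM -!mulrA.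
by rewrite -double_group_actionM mulgV double_group_action1 mulr1.
Qed.

Lemma double_indicatorE m :
  double_indicator W m = #|gT|%:R^-1 * \sum_u \sum_x
    ((u * x^-1) ^+ m * x ^+ m == 1)%g%:R * \tr (e u * rho (x ^+ m)%g).
Proof.
rewrite /double_indicator dsweedler_powE mulr_sumr !raddf_sum /=.
apply: eq_bigr => u _; rewrite mulr_sumr !raddf_sum; apply: eq_bigr => x _ /=.
rewrite double_idempotent_action linearZ mxtraceZ mulrA; congr (_ * _).
rewrite double_scaleE double_sumE; congr (_ * _).
rewrite (bigD1 x) //= dbasisE xpair_eqE eqxx andbT big1 ?addr0 // => y nyx.
by rewrite dbasisE xpair_eqE [x == y]eq_sym (negPf nyx) andbF.
Qed.

(** [S] is a class function, and a class has |G| / |C(u)| elements: the factor |C(u)| of [S u]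
    completes this to |G|, which cancels the normalisation. *)
Lemma int_valued_double_indicator n (a b : gT) m :
  quaternion_pair n a b -> int_valued (double_indicator W m).
Proof.
move=> qab; rewrite double_indicatorE.
pose S u : K := \sum_x ((u * x^-1) ^+ m * x ^+ m == 1)%g%:R
    * \tr (e u * rho (x ^+ m)%g).
have SJ : {in [set: gT] &, forall g h, S (g ^ h)%g = S g}.
  move=> g h _ _; rewrite /S (reindex_inj (conjg_inj h)) /=.
  apply: eq_bigr => x _; rewrite -conjVg -conjMg -!conjXg -conjMg.
  by rewrite double_trace_conj (can2_eq (conjgK h) (conjgKV h)) conj1g.
rewrite [X in _ * X](_ : _ = \sum_(u in [set: gT]) S u); last first.
  by apply: eq_bigl => u; rewrite inE.
rewrite sum_by_classes // mulr_sumr; apply: int_valued_sum => _ /imsetP[u _ ->].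
have [y _ ->] := repr_class [set: gT] u; rewrite SJ ?inE //.
have [|k def_k] := root_sum_divisible (u := u) qab m double_group_action1
  double_group_actionM (double_idempotentK u).
  move=> x /cent1P cxu.
  rewrite double_idempotent_action double_action_idempotent.
  by rewrite cxu mulgK.
exists k; rewrite [S u]def_k -index_cent1 setTI [X in _ * X]mulrA -natrM mulnC.
rewrite Lagrange ?subsetT //.
by rewrite cardsT mulrA mulVf ?mul1r // pnatr_eq0 -lt0n; apply/card_gt0P; exists 1%g.
Qed.

End DoubleModule.

(** The case e = 1 of [power_sum_divisible]. *)
Lemma int_valued_group_indicator (K : numFieldType) (gT : finGroupType) n
    (a b : gT) d (V : mx_representation K [set: gT] d) m :
  quaternion_pair n a b -> int_valued (group_indicator V m).
Proof.
move=> qab; rewrite /group_indicator.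
have V1 : V 1%g = 1 by rewrite repr_mx1.
have VM : {morph V : x y / (x * y)%g >-> x * y}.
  by move=> x y; rewrite repr_mxM ?inE.
have [|k def_k] := power_sum_divisible qab V1 VM (mulr1 1) _ m.
  by move=> y; rewrite mul1r mulr1.
exists k; rewrite (eq_bigl xpredT) => [|x]; last by rewrite inE.
rewrite (eq_bigr (fun x => \tr (1 * V (x ^+ m)%g))) => [|x _]; last by rewrite mul1r.
rewrite def_k cardsT (quaternion_card qab) mulrA mulVf ?mul1r //.
by rewrite -(quaternion_card qab) pnatr_eq0 -lt0n; apply/card_gt0P; exists 1%g.
Qed.

Theorem theorem7p6 (R : realType) (n : nat) (hn : (2 <= n)%N)
    (gT : finGroupType) (hG : gen_quaternion [set: gT] n)
    (dV : nat) (V : mx_representation R[i] [set: gT] dV)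
    (dW : nat) (W : {lrmorphism drinfeld_double R[i] gT -> 'M[R[i]]_dW})
    (m : nat) (hm : (0 < m)%N) :
  (exists k : int, group_indicator V m = k%:~R) /\
  (exists k : int, double_indicator W m = k%:~R).

Proof.
have [a [b qab]] := gen_quaternion_pair hn hG.
split; first exact: int_valued_group_indicator qab.
exact: int_valued_double_indicator qab.
Qed.
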